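(* For all $t, p \in \mathbb{N}$ with $t \geqslant p-2 \geqslant 1$, there exists a constant $c(t,p)$ such that, for all sufficiently large $n \in \mathbb{N}$, we have $\mathrm{sat}_{t}(n,p) = tn - c(t,p)$.
   Context: Graphs are finite and simple. $K_p$ denotes the complete graph on $p$ vertices, $e(G)$ the number of edges of $G$, and $\delta(G)$ the minimum degree of $G$. A graph $G$ is $H$-saturated if it contains no copy of $H$ as a (not necessarily induced) subgraph, but the addition of any new edge to $G$ (between two distinct non-adjacent vertices of $G$) creates a copy of $H$. Define $$\mathrm{sat}_{t}(n,p) = \min \{ e(G) : |V(G)| = n,\ G \text{ is } K_{p}\text{-saturated},\ \delta(G) \geqslant t \}.$$ For $t \geqslant p-2 \geqslant 1$ and $n$ sufficiently large (e.g. $n \geqslant 2t-(p-3)$) this set is nonempty, so the minimum is well defined. *)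

(* Defs.v *)
From mathcomp Require Import all_boot.
Set Implicit Arguments.
Unset Strict Implicit.
Unset Printing Implicit Defensive.

Record sgraph (V : finType) := SGraph {
  adj :> rel V;
  adj_sym : symmetric adj;
  adj_irrefl : irreflexive adj }.

Definition edges (V : finType) (G : sgraph V) : {set {set V}} :=
  [set [set x; y] | x in V, y in V & G x y].

Definition num_edges (V : finType) (G : sgraph V) : nat := #|edges G|.

Definition degree (V : finType) (G : sgraph V) (x : V) : nat :=
  #|[set y | G x y]|.

(* Every degree is less than #|V|, so the default #|V| does not affect the
   minimum when V is nonempty; on the empty graph the value is 0. *)
Definition min_degree (V : finType) (G : sgraph V) : nat :=
  \big[minn/#|V|]_(x : V) degree G x.

Lemma neq_sym (V : finType) : symmetric (fun x y : V => x != y).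
Proof. by move=> x y; rewrite eq_sym. Qed.

Lemma neq_irrefl (V : finType) : irreflexive (fun x y : V => x != y).
Proof. by move=> x; rewrite eqxx. Qed.

Definition complete_graph (p : nat) : sgraph 'I_p :=
  SGraph (@neq_sym 'I_p) (@neq_irrefl 'I_p).

(* Not necessarily induced: non-edges of H may be mapped to edges of G. *)
Definition contains_copy (W V : finType) (H : sgraph W) (G : sgraph V) : Prop :=
  exists2 f : W -> V, injective f & forall x y, H x y -> G (f x) (f y).

(* The conjunct u != v only matters when x = y, where no edge is added. *)
Definition add_edge_rel (V : finType) (G : sgraph V) (x y : V) : rel V :=
  fun u v => G u v || (u != v) && ([set u; v] == [set x; y]).

Lemma add_edge_sym (V : finType) (G : sgraph V) (x y : V) :
  symmetric (add_edge_rel G x y).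
Proof. by move=> u v; rewrite /add_edge_rel adj_sym eq_sym setUC. Qed.

Lemma add_edge_irrefl (V : finType) (G : sgraph V) (x y : V) :
  irreflexive (add_edge_rel G x y).
Proof. by move=> u; rewrite /add_edge_rel adj_irrefl eqxx. Qed.

Definition add_edge (V : finType) (G : sgraph V) (x y : V) : sgraph V :=
  SGraph (add_edge_sym G x y) (add_edge_irrefl G x y).

Definition saturated (W V : finType) (H : sgraph W) (G : sgraph V) : Prop :=
  ~ contains_copy H G /\
  forall x y : V, x != y -> ~~ G x y -> contains_copy H (add_edge G x y).

Definition is_minimum (S : nat -> Prop) (m : nat) : Prop :=
  S m /\ forall k, S k -> m <= k.

(* [is_sat t n p m] means that sat_t(n,p) is well defined and equal to m. *)
Definition is_sat (t n p m : nat) : Prop :=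
  is_minimum
    (fun k => exists G : sgraph 'I_n,
       [/\ saturated (complete_graph p) G, t <= min_degree G
         & num_edges G = k]) m.

(* Main.v *)
Require Import Defs.
From mathcomp Require Import all_boot all_order all_algebra.
From mathcomp Require Import zify.
From Stdlib Require Import Classical.
Import GRing.Theory.
Set Implicit Arguments.
Unset Strict Implicit.
Unset Printing Implicit Defensive.

(** The heart of the matter is a lower bound: a K_p-saturated graph on n
vertices with all degrees at least t has at least t n - C edges, with C
depending only on t ([saturated_edges_lb]).

Let R be a small set of vertices and absorb into it, one after the other, the
vertices having at least t neighbours among those already absorbed.  If A is
the resulting set, at least t (|A| - |R|) edges lie inside A, and every vertex
outside A has fewer than t neighbours in A.  Call the vertices outside A low or
high according to whether their degree is below 2t.  Give each edge with an end
outside A away as follows: an edge meeting A goes to its outer end, an edge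
between a low and a high vertex goes to the low one, and an edge between two
vertices of the same kind is shared equally.  If every outer vertex receives
at least t, the graph has at least t n - t |R| edges ([edge_count]).  If not,
there is a live vertex: a low vertex v adjacent either to a low vertex or to a
high vertex receiving less than t.

Saturation kills live vertices.  Let T be the set of neighbours of v in R,
and y the offending neighbour of v.  A vertex u with the same neighbours T in R
and not adjacent to y has p - 2 pairwise adjacent common neighbours with y, and
these cannot all lie in T, for together with v and y they would form a K_p.  So
once y and (the relevant part of) its neighbourhood have been added to R, every
such u has gained a neighbour in R.  Only boundedly many vertices are needed
for each T ([separator]), hence boundedly many to deal with all T inside R at
the same time ([absorbing_round]).  After t such rounds a live vertex would have
t neighbours in R, hence would have been absorbed: none is left.

For the equality, let n be large.  A complete multipartite graph shows that
sat_t(n,p) is defined and at most t n.  The lower bound for t + 1 then forces an extremal graph to have a vertex of degree exactly t, and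
duplicating it shows that sat_t(n+1,p) <= sat_t(n,p) + t
([admissible_clone]).  Thus t n - sat_t(n,p) is nondecreasing; being bounded
above, it is eventually constant. *)

(** * Cliques and saturation *)

Definition clique (V : finType) (G : sgraph V) (K : {set V}) : Prop :=
  {in K &, forall x y, x != y -> G x y}.

Section Copies.
Variables (V : finType) (G : sgraph V).

Lemma contains_complete p :
  contains_copy (complete_graph p) G <->
  exists2 K : {set V}, #|K| = p & clique G K.
Proof.
split=> [[f f_inj fG]|[K <- cK]].
  exists [set f i | i in 'I_p]; first by rewrite card_imset // card_ord.
  move=> _ _ /imsetP[i _ ->] /imsetP[j _ ->] ne_ij.
  by apply: fG => /=; apply: contraNneq ne_ij => ->.
exists (fun i => enum_val i); first exact: enum_val_inj.
move=> i j /= ne_ij; apply: cK; rewrite ?enum_valP //.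
by rewrite (inj_eq enum_val_inj).
Qed.

Lemma saturated_no_clique p (K : {set V}) :
  saturated (complete_graph p) G -> clique G K -> #|K| != p.
Proof.
by case=> noK _ cK; apply/eqP => cardK; apply/noK/contains_complete; exists K.
Qed.

(** A copy of the complete graph created by the new edge xy must use both
ends of it; what remains is a clique of old edges. *)
Lemma saturated_common_clique r x y :
  saturated (complete_graph r.+2) G -> x != y -> ~~ G x y ->
  exists K : {set V}, [/\ #|K| = r, clique G K
    & {in K, forall z, G x z && G y z}].
Proof.
move=> satG ne_xy nGxy; have [_ /(_ x y ne_xy nGxy)] := satG.
case=> f f_inj fG.
set K := [set f i | i in 'I_r.+2].
have cardK : #|K| = r.+2 by rewrite card_imset // card_ord.
have cK u v : u \in K -> v \in K -> u != v -> add_edge_rel G x y u v.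
  move=> /imsetP[i _ ->] /imsetP[j _ ->] ne_ij.
  by apply: (fG i j) => /=; apply: contraNneq ne_ij => ->.
have Kxy z : z \in [set x; y] -> z \in K.
  move=> zxy; apply: contraT => zK.
  have := saturated_no_clique satG (K := K); rewrite cardK eqxx; apply=> u v uK vK ne_uv.
  case/orP: (cK u v uK vK ne_uv) => // /andP[_ /eqP uv].
  by move: zxy; rewrite -uv !inE => /orP[]/eqP zE; rewrite zE ?uK ?vK in zK.
have xK : x \in K by apply: Kxy; rewrite !inE eqxx.
have yK : y \in K by apply: Kxy; rewrite !inE eqxx orbT.
have GK u v : u \in K -> v \in K -> u != v -> v \notin [set x; y] -> G u v.
  move=> uK vK ne_uv vxy; case/orP: (cK u v uK vK ne_uv) => // /andP[_ /eqP uv].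
  by move: vxy; rewrite -uv !inE eqxx orbT.
exists (K :\ x :\ y); split.
- have := cardsD1 x K; have := cardsD1 y (K :\ x).
  by rewrite !inE xK yK eq_sym ne_xy cardK /=; lia.
- move=> u v; rewrite !inE => /and3P[_ _ uK] /and3P[vy vx vK] ne_uv.
  by apply: GK; rewrite // !inE negb_or vx.
move=> z; rewrite !inE => /and3P[zy zx zK].
by rewrite !GK // 1?eq_sym // !inE negb_or zx.
Qed.

Lemma saturatedI r :
    (forall K : {set V}, clique G K -> #|K| != r.+2) ->
    (forall x y, x != y -> ~~ G x y -> exists K : {set V},
      [/\ #|K| = r, clique G K & {in K, forall z, G x z && G y z}]) ->
  saturated (complete_graph r.+2) G.
Proof.
move=> noK comK; split.
  by case/contains_complete=> K cardK /noK; rewrite cardK eqxx.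
move=> x y ne_xy nGxy; have [K [cardK cK Kxy]] := comK x y ne_xy nGxy.
have notK z : ~~ G z z by rewrite adj_irrefl.
have xK : x \notin K by apply: contraNN (notK x) => /Kxy/andP[].
have yK : y \notin K by apply: contraNN (notK y) => /Kxy/andP[].
pose K2 := x |: (y |: K).
have cardK2 : #|K2| = r.+2.
  by rewrite !cardsU1 !inE negb_or ne_xy xK yK cardK.
have cK2 u v : u \in K2 -> v \in K2 -> u != v -> add_edge_rel G x y u v.
  rewrite !inE /add_edge_rel => /or3P[/eqP->|/eqP->|uK] /or3P[/eqP->|/eqP->|vK];
    move=> ne_uv; rewrite ?ne_uv ?eqxx ?orbT //;
    rewrite ?eqxx // in ne_uv.
  - by case/andP: (Kxy v vK) => ->.
  - by rewrite setUC eqxx orbT.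
  - by case/andP: (Kxy v vK) => _ ->.
  - by rewrite adj_sym; case/andP: (Kxy u uK) => ->.
  - by rewrite adj_sym; case/andP: (Kxy u uK) => _ ->.
  - by rewrite cK.
have Kord (i : 'I_r.+2) : enum_val (cast_ord (esym cardK2) i) \in K2.
  exact: enum_valP.
exists (fun i => enum_val (cast_ord (esym cardK2) i)).
  by move=> i j /enum_val_inj/cast_ord_inj.
move=> i j /= ne_ij; apply: cK2 => //.
by rewrite (inj_eq enum_val_inj) (inj_eq (@cast_ord_inj _ _ _)).
Qed.

End Copies.

(** * Degrees and edges *)

Section Counting.
Variables (V : finType) (G : sgraph V).

Definition deg_in (B : {set V}) (x : V) : nat := \sum_(y in B) G x y.

Lemma deg_inE (B : {set V}) x : deg_in B x = #|[set y in B | G x y]|.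
Proof.
rewrite /deg_in -big_mkcondr /= sum1_card.
by apply: eq_card => y; rewrite !inE.
Qed.

Lemma degreeE x : degree G x = \sum_y G x y.
Proof. by rewrite /degree -sum1dep_card big_mkcond; apply: eq_bigr => y; case: (G x y). Qed.

Lemma min_degree_le x : min_degree G <= degree G x.
Proof.
rewrite /min_degree; have: x \in index_enum V by rewrite mem_index_enum.
elim: (index_enum V) => //= y s IHs; rewrite inE big_cons geq_min.
by case/orP=> [/eqP->|/IHs->]; rewrite ?leqnn ?orbT.
Qed.

Lemma min_degree_ge t :
  t <= #|V| -> (forall x, t <= degree G x) -> t <= min_degree G.
Proof.
move=> tV tdeg; rewrite /min_degree.
by elim/big_ind: _ => // m n tm tn; rewrite leq_min tm.
Qed.

(** Every edge is the image of exactly two ordered pairs. *)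
Lemma handshake : \sum_x degree G x = 2 * num_edges G.
Proof.
pose P := [set u : V * V | G u.1 u.2].
have -> : \sum_x degree G x = #|P|.
  rewrite -sum1dep_card -(pair_big_dep xpredT (fun x y => G x y) (fun _ _ => 1)) /=.
  by apply: eq_bigr => x _; rewrite sum1dep_card.
pose h (u : V * V) := [set u.1; u.2].
rewrite /num_edges; have -> : edges G = h @: P.
  apply/setP=> e; apply/imset2P/imsetP.
    by case=> x y _; rewrite !inE => Gxy ->; exists (x, y); rewrite ?inE.
  case=> [[x y]]; rewrite inE /= => Gxy ->; exists x y => //.
  by rewrite inE Gxy.
rewrite -sum1_card (partition_big_imset h) /= mulnC -sum_nat_const.
apply: eq_bigr => _ /imsetP[[x y] /[!inE]/= Gxy ->].
have ne_xy : x != y by apply: contraTneq Gxy => ->; rewrite adj_irrefl.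
rewrite sum1dep_card.
have -> : 2 = #|[set (x, y); (y, x)]| by rewrite cards2 xpair_eqE (negbTE ne_xy).
apply: eq_card => [[a b]]; rewrite !inE /= /h /= !xpair_eqE.
apply/andP/orP.
  case=> Gab /eqP ab.
  have ne_ab : a != b by apply: contraTneq Gab => ->; rewrite adj_irrefl.
  have : a \in [set x; y] by rewrite -ab !inE eqxx.
  have : b \in [set x; y] by rewrite -ab !inE eqxx orbT.
  rewrite !inE => /orP[]/eqP bE /orP[]/eqP aE; subst;
    rewrite ?eqxx in ne_ab *; by [left | right | ].
case=> /andP[/eqP-> /eqP->]; rewrite ?eqxx; first by [].
by rewrite adj_sym Gxy setUC.
Qed.

(** Edges inside [A :&: B] are counted twice: these are ordered pairs. *)
Definition pairs (A B : {set V}) : nat := \sum_(x in A) deg_in B x.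

Lemma pairsC A B : pairs A B = pairs B A.
Proof.
rewrite /pairs /deg_in exchange_big /=; apply: eq_bigr => y _.
by apply: eq_bigr => x _; rewrite adj_sym.
Qed.

End Counting.

(** * The lower bound *)

Section Absorption.
Variables (V : finType) (G : sgraph V) (t : nat).
Implicit Types (A B R S T X : {set V}) (x y z u v : V).

(** The vertices of A that are not in R are paid for by t edges inside A each;
everything is doubled because [pairs] counts ordered pairs. *)
Definition paid R A : bool :=
  2 * t * #|A| <= pairs G A A + 2 * t * #|R|.

Definition absorbing R A : Prop :=
  [/\ R \subset A, paid R A & forall v, v \notin A -> deg_in G A v < t].

(** The threshold 2t is what makes a high vertex with few neighbours that are
absorbed or high have a low neighbour. *)
Definition low A : {set V} := [set x | (x \notin A) && (degree G x < 2 * t)].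
Definition high A : {set V} := [set x | (x \notin A) && (2 * t <= degree G x)].

(** The high vertices whose share of the edges is below t: full edges to A,
half edges to high vertices, nothing from low vertices. *)
Definition poor A z : bool :=
  (z \in high A) && (2 * deg_in G A z + deg_in G (high A) z < 2 * t).

(** If no vertex is live then low vertices are pairwise non-adjacent, so each
of them is given all of its edges, and no high vertex is poor. *)
Definition live A v : bool :=
  (v \in low A) && [exists z, G v z && ((z \in low A) || poor A z)].

Definition trace R v : {set V} := [set x in R | G v x].

Lemma deg_in_subset A B x : A \subset B -> deg_in G A x <= deg_in G B x.
Proof.
move=> AB; rewrite !deg_inE; apply: subset_leq_card.
by apply/subsetP=> y; rewrite !inE => /andP[/(subsetP AB)-> ->].
Qed.

Lemma degree_split A x :
  degree G x = deg_in G A x + deg_in G (low A) x + deg_in G (high A) x.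
Proof.
rewrite degreeE (bigID (mem A)) /= -addnA; congr addn.
rewrite (bigID (fun y => degree G y < 2 * t)) /= /deg_in.
congr addn; apply: eq_bigl => y; rewrite inE //.
by rewrite -leqNgt.
Qed.

(** A neighbour that becomes absorbed contributes at least as much to the share
of a high vertex as it did before. *)
Lemma live_mono A A' v : A \subset A' -> live A' v -> live A v.
Proof.
move=> AA'; have NA x : x \notin A' -> x \notin A.
  by apply: contraNN => /(subsetP AA').
case/andP=> vlow /existsP[z /andP[Gvz zbad]]; apply/andP; split.
  by move: vlow; rewrite !inE => /andP[/NA-> ->].
apply/existsP; exists z; rewrite Gvz /=.
case/orP: zbad => [|/andP[zhigh zpoor]].
  by rewrite !inE => /andP[/NA-> ->].
apply/orP; right; apply/andP; split.
  by move: zhigh; rewrite !inE => /andP[/NA-> ->].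
apply: leq_ltn_trans zpoor.
have lowS : deg_in G (low A') z <= deg_in G (low A) z.
  by apply: deg_in_subset; apply/subsetP=> x; rewrite !inE => /andP[/NA-> ->].
have := degree_split A z; have := degree_split A' z.
have := deg_in_subset z AA'.
by lia.
Qed.

Lemma paid_grow R A S : R \subset A -> paid R A -> paid (R :|: S) (A :|: S).
Proof.
move=> RA; rewrite /paid => pRA.
have pAS : pairs G A A <= pairs G (A :|: S) (A :|: S).
  rewrite /pairs [X in _ <= X](bigID (mem A)) /=.
  apply: leq_trans (leq_addr _ _).
  have -> : \sum_(i in A :|: S | i \in A) deg_in G (A :|: S) i
          = \sum_(i in A) deg_in G (A :|: S) i.
    by apply: eq_bigl => i; rewrite inE; case: (i \in A); rewrite ?andbF.
  by apply: leq_sum => i _; apply/deg_in_subset/subsetUl.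
have cAS : #|A :|: S| + #|R| <= #|A| + #|R :|: S|.
  have := cardsUI A S; have := cardsUI R S.
  have := subset_leq_card (setSI S RA).
  by lia.
have := leq_mul (leqnn (2 * t)) cAS; rewrite !mulnDr.
by lia.
Qed.

(** Absorbing a vertex with at least t neighbours in A pays for itself. *)
Lemma absorb R A : R \subset A -> paid R A ->
  exists2 B : {set V}, A \subset B & absorbing R B.
Proof.
move=> RA pA; have [m] := ubnP #|~: A|.
elim: m A RA pA => // m IHm A RA pA; rewrite ltnS => cA.
have [/existsP[v /andP[vA tv]]|] := boolP [exists v, (v \notin A) && (t <= deg_in G A v)].
  have AvA : A \subset v |: A by apply: subsetUr.
  have [||| B AB absB] := IHm (v |: A).
  - exact: subset_trans AvA.
  - rewrite /paid; have -> : pairs G (v |: A) (v |: A) = pairs G A A + 2 * deg_in G A v.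
      have degU x : deg_in G (v |: A) x = G x v + deg_in G A x by rewrite /deg_in big_setU1.
      rewrite {1}/pairs big_setU1 //= degU adj_irrefl add0n.
      under eq_bigr do rewrite degU.
      rewrite big_split /= -/(pairs G A A).
      have -> : \sum_(i in A) G i v = deg_in G A v by apply: eq_bigr => i _; rewrite adj_sym.
      by lia.
    by move: pA; rewrite /paid cardsU1 vA; nia.
  - apply: leq_trans cA; apply: proper_card; rewrite properC.
    by rewrite properE AvA /=; apply/subsetPn; exists v; rewrite ?inE ?eqxx.
  by exists B => //; apply: subset_trans AB.
rewrite negb_exists => /forallP noV; exists A => //; split=> // v vA.
by have := noV v; rewrite vA /= -ltnNge.
Qed.

(** The double count described at the top, with all shares doubled. *)
Lemma edge_count R A : absorbing R A -> (forall x, t <= degree G x) ->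
  (forall v, ~~ live A v) -> t * #|V| <= num_edges G + t * #|R|.
Proof.
case=> RA pA clA tdeg nolive.
have split_sum (F : V -> nat) :
    \sum_x F x = \sum_(x in A) F x + \sum_(x in low A) F x + \sum_(x in high A) F x.
  rewrite (bigID (mem A)) /= -addnA; congr addn.
  rewrite (bigID (fun y => degree G y < 2 * t)) /=.
  congr addn; apply: eq_bigl => y; rewrite inE //.
  by rewrite -leqNgt.
have lowE v : v \in low A -> deg_in G (low A) v = 0.
  move=> vlow; apply: big1 => z zlow; have := nolive v.
  rewrite /live vlow /= negb_exists => /forallP/(_ z).
  by rewrite zlow andbT => /negbTE->.
have lowP : t * #|low A| <= pairs G (low A) A + pairs G (low A) (high A).
  rewrite mulnC -sum_nat_const -big_split /=; apply: leq_sum => v vlow.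
  by have := degree_split A v; have := tdeg v; rewrite (lowE v vlow); lia.
have highP : 2 * t * #|high A| <= 2 * pairs G (high A) A + pairs G (high A) (high A).
  rewrite mulnC -sum_nat_const big_distrr -big_split /=.
  apply: leq_sum => z zhigh; rewrite leqNgt; apply/negP => zpoor.
  have pz : poor A z by rewrite /poor zhigh.
  (* deg z is at least 2t, of which fewer than 2t go to A and high vertices *)
  have dz : deg_in G (low A) z > 0.
    by move: (zhigh); rewrite inE => /andP[_]; have := degree_split A z; lia.
  have [v vlow Gzv] : exists2 v, v \in low A & G z v.
    apply/exists_inP; apply: contraLR dz; rewrite negb_exists_in => /forall_inP noz.
    by rewrite -eqn0Ngt; apply/eqP/big1 => v /noz/negbTE->.
  have := nolive v; rewrite /live vlow /= negb_exists => /forallP/(_ z).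
  by rewrite adj_sym Gzv pz orbT.
have := handshake G; rewrite (split_sum (degree G)).
have expand X : \sum_(x in X) degree G x
    = pairs G X A + pairs G X (low A) + pairs G X (high A).
  by rewrite -!big_split; apply: eq_bigr => x _; apply: degree_split.
have cV : #|V| = #|A| + #|low A| + #|high A|.
  by rewrite -!sum1_card -(split_sum (fun=> 1)); apply: eq_bigl.
rewrite !expand cV !mulnDr (pairsC G A (low A)) (pairsC G A (high A)).
rewrite (pairsC G (high A) (low A)).
by move: pA; rewrite /paid; lia.
Qed.

(** One bounded set S gives a new neighbour in S to all live vertices outside S
whose trace is T.  If some low vertex with trace T has a low neighbour y, take y
and all its neighbours.  Otherwise the witness of liveness is a poor vertex z,
whose low neighbours may be too many; but a vertex with trace T then has no
low neighbour, so z together with its neighbours that are not low suffices. *)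
Lemma separator r R A T : saturated (complete_graph r.+2) G -> absorbing R A ->
  exists2 S : {set V}, #|S| <= 2 * t &
    forall u, live A u -> trace R u = T -> u \notin S ->
      exists2 x, x \in S :\: R & G u x.
Proof.
move=> satG [RA _ _].
(* T, v and y would otherwise contain a complete graph on r + 2 vertices *)
have noKT v y (K : {set V}) : trace R v = T -> G v y -> #|K| = r -> clique G K ->
    {in K, forall x, G y x} -> ~~ (K \subset T).
  move=> vT Gvy cardK cK Ky; apply/negP => KT.
  have Kv x : x \in K -> G v x.
    by move/(subsetP KT); rewrite -vT inE => /andP[].
  have vK : v \notin K by apply: contraT => /negPn/Kv; rewrite adj_irrefl.
  have yK : y \notin K by apply: contraT => /negPn/Ky; rewrite adj_irrefl.
  have ne_vy : v != y by apply: contraTneq Gvy => ->; rewrite adj_irrefl.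
  have cK2 : clique G (v |: (y |: K)).
    move=> a b; rewrite !inE => /or3P[/eqP->|/eqP->|aK] /or3P[/eqP->|/eqP->|bK];
      rewrite ?eqxx // => ne_ab; last exact: cK.
    - exact: Kv.
    - by rewrite adj_sym.
    - exact: Ky.
    - by rewrite adj_sym Kv.
    - by rewrite adj_sym Ky.
  have := saturated_no_clique satG cK2.
  by rewrite !cardsU1 !inE negb_or ne_vy vK yK cardK eqxx.
have [/existsP[v /existsP[y /and4P[vlow /eqP vT ylow Gvy]]]|] := boolP [exists v,
    exists y, [&& v \in low A, trace R v == T, y \in low A & G v y]].
  exists (y |: [set x | G y x]).
    rewrite cardsU1 !inE adj_irrefl add1n.
    by move: ylow; rewrite inE => /andP[].
  move=> u _ uT; rewrite !inE negb_or => /andP[ne_uy nGyu].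
  have [|K [cardK cK Kuy]] := saturated_common_clique satG ne_uy.
    by rewrite adj_sym.
  have /subsetPn[x xK xT] : ~~ (K \subset T).
    by apply: (noKT v y K) => // x /Kuy/andP[].
  have /andP[Gux Gyx] := Kuy x xK; exists x => //.
  rewrite !inE Gyx orbT andbT; apply: contraNN xT => xR.
  by rewrite -uT inE xR.
move=> nolow.
have {}nolow u y : u \in low A -> trace R u = T -> G u y -> y \notin low A.
  move=> ulow uT Guy; apply: contraNN nolow => ylow.
  by apply/existsP; exists u; apply/existsP; exists y; rewrite ulow uT eqxx ylow.
have [/existsP[v /andP[vlive /eqP vT]]|noT] := boolP [exists v, live A v && (trace R v == T)]; last first.
  exists set0; first by rewrite cards0.
  move=> u ulive uT; case/negP: noT.
  by apply/existsP; exists u; rewrite ulive uT eqxx.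
case/andP: vlive => vlow /existsP[z /andP[Gvz]].
rewrite (negbTE (nolow v z vlow vT Gvz)) /= => /andP[zhigh zpoor].
exists (z |: [set x | G z x & x \notin low A]).
  rewrite cardsU1 !inE adj_irrefl add1n; apply: leq_ltn_trans zpoor.
  apply: leq_trans (_ : deg_in G A z + deg_in G (high A) z <= _); last by lia.
  rewrite !deg_inE -cardsUI; apply: leq_trans (leq_addr _ _).
  apply/subset_leq_card/subsetP=> x; rewrite !inE => /andP[->].
  by case: (x \in A) => //=; rewrite -leqNgt => ->.
move=> u /andP[ulow _] uT; rewrite !inE negb_or => /andP[ne_uz _].
have zA : z \notin A by move: zhigh; rewrite inE => /andP[].
have zR : z \notin R by apply: contraNN zA => /(subsetP RA).
have [Guz|nGuz] := boolP (G u z).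
  by exists z => //; rewrite !inE eqxx zR.
have [K [cardK cK Kuz]] := saturated_common_clique satG ne_uz nGuz.
have /subsetPn[x xK xT] : ~~ (K \subset T).
  by apply: (noKT v z K) => // x /Kuz/andP[].
have /andP[Gux Gzx] := Kuz x xK; exists x => //.
have xlow := nolow u x ulow uT Gux; rewrite inE in xlow.
rewrite !inE Gzx xlow orbT andbT; apply: contraNN xT => xR.
by rewrite -uT inE xR.
Qed.

(** All traces inside R are treated simultaneously; there are 2 ^ |R| of
them.  Measuring progress by neighbours in R rather than in the unbounded set A
is what keeps this number bounded. *)
Lemma absorbing_round r R A : saturated (complete_graph r.+2) G ->
  absorbing R A -> exists R' A', [/\ absorbing R' A',
    #|R'| <= #|R| + 2 ^ #|R| * (2 * t) &
    forall v, live A' v -> live A v && (#|trace R v| < #|trace R' v|)].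
Proof.
move=> satG absRA; have [RA pA _] := absRA.
have /fin_all_exists[S SP] : forall T : {set V}, exists S : {set V},
    #|S| <= 2 * t /\ forall u, live A u -> trace R u = T -> u \notin S ->
      exists2 x, x \in S :\: R & G u x.
  by move=> T; have [S] := separator T satG absRA; exists S.
pose U := \bigcup_(T in powerset R) S T.
have [B AB absB] := absorb (setSU U RA) (paid_grow U RA pA).
exists (R :|: U), B; split=> //.
  apply: leq_trans (leq_card_setU _ _) _; rewrite leq_add2l -card_powerset.
  rewrite -sum_nat_const /U.
  elim/big_rec2: _ => [|T s W _ IH]; first by rewrite cards0.
  apply: leq_trans (leq_card_setU _ _) _; apply: leq_add => //.
  by case: (SP T).
move=> v vlive; have AB' : A \subset B by apply: subset_trans AB; apply: subsetUl.
have vliveA := live_mono AB' vlive; rewrite vliveA /=.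
have [_ SPv] := SP (trace R v).
have SU : S (trace R v) \subset U.
  apply: bigcup_sup; rewrite inE; apply/subsetP=> x.
  by rewrite inE => /andP[].
have [|x] := SPv v vliveA erefl.
  case/andP: vlive; rewrite inE => /andP[vB _] _.
  apply: contraNN vB => /(subsetP SU) vU.
  by apply: (subsetP AB); rewrite inE vU orbT.
rewrite inE => /andP[xR /(subsetP SU) xU] Gvx.
apply: proper_card; apply/properP; split.
  by apply/subsetP=> y; rewrite !inE => /andP[-> ->].
by exists x; rewrite !inE ?xU ?Gvx ?orbT // (negbTE xR).
Qed.

End Absorption.

(** The size of R after i rounds. *)
Fixpoint round_bound (t i : nat) : nat :=
  if i is j.+1 then round_bound t j + 2 ^ round_bound t j * (2 * t) else 0.

Lemma saturated_edges_lb (V : finType) (G : sgraph V) (t r : nat) :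
  saturated (complete_graph r.+2) G -> (forall x, t <= degree G x) ->
  t * #|V| <= num_edges G + t * round_bound t t.
Proof.
move=> satG tdeg.
have rounds i : exists R A, [/\ absorbing G t R A, #|R| <= round_bound t i
    & forall v, live G t A v -> i <= #|trace G R v|].
  elim: i => [|i [R [A [absA cR liveA]]]].
    have [||A _ absA] := @absorb _ G t set0 set0; rewrite ?sub0set //.
      by rewrite /paid !cards0 !muln0.
    by exists set0, A; split; rewrite ?cards0.
  have [R' [A' [absA' cR' liveA']]] := absorbing_round satG absA.
  exists R', A'; split=> // [|v /liveA'/andP[/liveA vi]].
    apply: leq_trans cR' _; rewrite leq_add // leq_mul // leq_exp2l //.
  exact: leq_ltn_trans.
have [R [A [absA cR liveA]]] := rounds t.
apply: leq_trans (edge_count absA tdeg _) _; last by rewrite leq_add2l leq_mul.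
move=> v; apply/negP => vlive; have := liveA v vlive.
have [RA _ clA] := absA.
case/andP: vlive; rewrite inE => /andP[/clA vt _] _.
apply/negP; rewrite -ltnNge; apply: leq_ltn_trans vt; rewrite deg_inE.
apply/subset_leq_card/subsetP=> x; rewrite !inE => /andP[/(subsetP RA)-> ->] //.
Qed.

(** * Blow-ups *)

Section Pullback.
Variables (V W : finType) (G : sgraph V) (phi : W -> V).

Lemma pullback_sym : symmetric (fun x y => G (phi x) (phi y)).
Proof. by move=> x y; apply: adj_sym. Qed.

Lemma pullback_irrefl : irreflexive (fun x y => G (phi x) (phi y)).
Proof. by move=> x; apply: adj_irrefl. Qed.

Definition pullback : sgraph W := SGraph pullback_sym pullback_irrefl.

(** Cliques of the pullback project injectively and those of G lift along the
section s, so only pairs of distinct vertices in one fibre need an argument. *)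
Lemma saturated_pullback r (s : V -> W) :
    cancel s phi -> saturated (complete_graph r.+2) G ->
    (forall x y, x != y -> phi x = phi y -> exists K : {set V},
      [/\ #|K| = r, clique G K & {in K, forall z, G (phi x) z}]) ->
  saturated (complete_graph r.+2) pullback.
Proof.
move=> sK satG twinK; apply: saturatedI => [K cK|x y neq_xy nGxy].
  have phi_inj : {in K &, injective phi}.
    move=> x y xK yK eq_xy; apply: contraTeq isT => /(cK x y xK yK) /=.
    by rewrite eq_xy adj_irrefl.
  rewrite -(card_in_imset phi_inj); apply: (saturated_no_clique satG).
  move=> _ _ /imsetP[x xK ->] /imsetP[y yK ->] ne_xy.
  by apply: cK => //; apply: contraNneq ne_xy => ->.
have [K [cardK cK Kxy]] : exists K : {set V}, [/\ #|K| = r, clique G K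
    & {in K, forall z, G (phi x) z && G (phi y) z}].
  have [eq_xy|ne_xy] := eqVneq (phi x) (phi y); last first.
    exact: saturated_common_clique.
  have [K [cardK cK Kx]] := twinK x y neq_xy eq_xy.
  by exists K; split=> // z /Kx Gxz; rewrite -eq_xy Gxz.
exists (s @: K); split; first by rewrite card_imset //; apply: can_inj sK.
  move=> _ _ /imsetP[a aK ->] /imsetP[b bK ->] ne_ab /=.
  by rewrite !sK; apply: cK => //; apply: contraNneq ne_ab => ->.
by move=> _ /imsetP[a aK ->] /=; rewrite !sK; apply: Kxy.
Qed.

End Pullback.

(** The last vertex is the copy of v. *)
Definition unclone (n : nat) (v : 'I_n) (x : 'I_n.+1) : 'I_n :=
  odflt v (unlift ord_max x).

Lemma unclone_lift n (v i : 'I_n) : unclone v (widen_ord (leqnSn n) i) = i.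
Proof.
rewrite /unclone; have -> : widen_ord (leqnSn n) i = lift ord_max i.
  by apply: val_inj; rewrite /= /bump leqNgt ltn_ord.
by rewrite liftK.
Qed.

Lemma unclone_max n (v : 'I_n) : unclone v ord_max = v.
Proof. by rewrite /unclone unlift_none. Qed.

Lemma unclone_collision n (v : 'I_n) x y :
  x != y -> unclone v x = unclone v y -> unclone v x = v.
Proof.
rewrite /unclone.
case: unliftP => [i ->|-> //]; case: unliftP => [j ->|-> //] /= + ij.
by rewrite ij eqxx.
Qed.

Definition clone n (G : sgraph 'I_n) (v : 'I_n) : sgraph 'I_n.+1 :=
  pullback G (unclone v).

Lemma degree_clone n (G : sgraph 'I_n) v x :
  degree (clone G v) x = degree G (unclone v x) + G (unclone v x) v.
Proof.
rewrite !degreeE big_ord_recr /= unclone_max; congr addn.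
by apply: eq_bigr => i _; rewrite unclone_lift.
Qed.

Lemma num_edges_clone n (G : sgraph 'I_n) v :
  num_edges (clone G v) = num_edges G + degree G v.
Proof.
apply/eqP; rewrite -(eqn_pmul2l (isT : 0 < 2)) mulnDr -!handshake; apply/eqP.
rewrite big_ord_recr /= degree_clone unclone_max adj_irrefl addn0.
under eq_bigr do rewrite degree_clone unclone_lift.
rewrite big_split /= -addnA mul2n -addnn; congr (_ + (_ + _)).
by rewrite degreeE; apply: eq_bigr => i _; rewrite adj_sym.
Qed.

Definition admissible (t p n k : nat) : Prop :=
  exists G : sgraph 'I_n,
    [/\ saturated (complete_graph p) G, t <= min_degree G & num_edges G = k].

(** If all degrees were at least t + 1, the lower bound for t + 1 would exceed
t n; so some vertex has degree t, and its copy brings t new edges. *)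
Lemma admissible_clone t r n k : admissible t r.+2 n k -> k <= t * n ->
  t.+1 * round_bound t.+1 t.+1 < n -> t.+1 < n -> admissible t r.+2 n.+1 (k + t).
Proof.
case=> G [satG tdeg <-] ub big_n tn.
have degG x := leq_trans tdeg (min_degree_le G x).
have [v degv] : exists v, degree G v = t.
  have [/existsP[v /eqP]|] := boolP [exists v, degree G v == t]; first by exists v.
  rewrite negb_exists => /forallP noV.
  have := @saturated_edges_lb _ G t.+1 r satG; rewrite card_ord => lb.
  suff: t.+1 * n <= num_edges G + t.+1 * round_bound t.+1 t.+1.
    by move: ub big_n; rewrite mulSn; lia.
  by apply: lb => x; rewrite ltn_neqAle eq_sym noV degG.
exists (clone G v); split; last by rewrite num_edges_clone degv.
  have [w [ne_vw nGvw]] : exists w, v != w /\ ~~ G v w.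
    have : ~~ ([set: 'I_n] \subset v |: [set y | G v y]).
      apply: contraL tn => /subset_leq_card.
      by rewrite cardsT card_ord cardsU1 -/(degree G v) degv; lia.
    case/subsetPn=> w _; rewrite !inE negb_or eq_sym => /andP[? ?]; by exists w.
  apply: (@saturated_pullback _ _ _ _ r (widen_ord (leqnSn n))) => //.
    exact: unclone_lift.
  move=> x y ne_xy /(unclone_collision ne_xy)->.
  have [K [cardK cK Kvw]] := saturated_common_clique satG ne_vw nGvw.
  by exists K; split=> // z /Kvw/andP[].
apply: min_degree_ge => [|x]; first by rewrite card_ord ltnW // ltnW // ltnW.
by rewrite degree_clone; apply: leq_trans (leq_addr _ _).
Qed.

(** * A complete multipartite example *)

Lemma saturated_complete r : saturated (complete_graph r.+2) (complete_graph r.+1).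
Proof.
apply: saturatedI => [K _|x y /= -> //].
by rewrite neq_ltn ltnS; have := max_card (mem K); rewrite card_ord => ->.
Qed.

Section Multipartite.
Variables (t r n : nat).
Hypotheses (r_gt0 : 0 < r) (rt : r <= t) (tn : 2 * t <= n.+1).

(** Parts 0, ..., r - 2 are singletons, part r - 1 consists of the remaining
t - r + 1 vertices below t, and part r of all vertices from t on, so that the
latter have degree t. *)
Definition part (x : 'I_n.+1) : 'I_r.+1 :=
  inord (if x < t then minn x r.-1 else r).

Definition representative (c : 'I_r.+1) : 'I_n.+1 :=
  inord (if c < r then nat_of_ord c else t).

Definition multipartite : sgraph 'I_n.+1 := pullback (complete_graph r.+1) part.

Lemma partE x : part x = (if x < t then minn x r.-1 else r) :> nat.
Proof. by rewrite inordK //; case: ifP => _; lia. Qed.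

Lemma representativeK : cancel representative part.
Proof.
move=> c; apply: val_inj; have := ltn_ord c; rewrite /= partE inordK.
  by case: (ltnP c r) => cr; [rewrite (leq_trans cr rt) | rewrite ltnn]; lia.
by case: ifP; lia.
Qed.

Lemma multipartite_saturated : saturated (complete_graph r.+2) multipartite.
Proof.
apply: saturated_pullback representativeK (saturated_complete r) _ => x y _ _.
exists [set~ part x]; split=> //; first by rewrite cardsC1 card_ord.
by move=> z; rewrite !inE eq_sym.
Qed.

Lemma crossing_adj (x y : 'I_n.+1) : x < t -> t <= y -> multipartite x y.
Proof.
move=> xt ty; rewrite /= -val_eqE /= !partE xt ltnNge ty /=.
by lia.
Qed.

Lemma card_below : #|[set x : 'I_n.+1 | x < t]| = t.
Proof.
have tn1 : t <= n.+1 by lia.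
have inj : injective (widen_ord tn1) by move=> i j /(congr1 val)/= /val_inj.
rewrite -[RHS]card_ord -cardsT -(card_imset _ inj).
apply: eq_card => x; rewrite inE; apply/idP/imsetP => [xt|[i _ ->]] /=.
  by exists (Ordinal xt) => //; apply: val_inj.
exact: ltn_ord.
Qed.

Lemma multipartite_degree x : t <= degree multipartite x.
Proof.
have [xt|tx] := ltnP x t.
  have := cardsC [set x : 'I_n.+1 | x < t]; rewrite card_below card_ord => cC.
  apply: leq_trans (_ : #|~: [set x : 'I_n.+1 | x < t]| <= _); first by lia.
  apply/subset_leq_card/subsetP=> y; rewrite !inE -leqNgt.
  exact: crossing_adj.
rewrite -[X in X <= _]card_below; apply/subset_leq_card/subsetP=> y.
by rewrite !inE adj_sym => yt; apply: crossing_adj.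
Qed.

(** The vertices from t on form an independent set, so each edge is determined
by an end below t and another vertex. *)
Lemma multipartite_num_edges : num_edges multipartite <= t * n.+1.
Proof.
rewrite -[X in X * _]card_below -[X in _ * X]card_ord -cardsT -cardsX.
apply: leq_trans (leq_imset_card (fun u => [set u.1; u.2]) _).
apply/subset_leq_card/subsetP=> _ /imset2P[x y _ /[!inE] /andP[_ Gxy] ->].
have [xt|tx] := ltnP x t.
  by apply/imsetP; exists (x, y); rewrite // !inE xt.
apply/imsetP; exists (y, x); last by rewrite setUC.
rewrite !inE andbT ltnNge; apply: contraTN Gxy => ty.
by rewrite negbK -val_eqE /= !partE !ltnNge tx ty.
Qed.

End Multipartite.

Lemma admissible_small t r n : 0 < r -> r <= t -> 2 * t <= n -> 0 < n ->
  exists2 k, admissible t r.+2 n k & k <= t * n.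
Proof.
case: n => // n r_gt0 rt tn _; exists (num_edges (multipartite t r n)).
  exists (multipartite t r n); split=> //; first exact: multipartite_saturated.
  apply: min_degree_ge => [|x]; first by rewrite card_ord; lia.
  exact: multipartite_degree.
exact: multipartite_num_edges.
Qed.

(** * The constant *)

Lemma least_nat (P : nat -> Prop) :
  (exists n, P n) -> exists m, is_minimum P m.
Proof.
case=> n Pn; apply: NNPP => noMin; have [m] := ubnP n.
elim: m n Pn => // m IHm n Pn; rewrite ltnS => nm.
apply: noMin; exists n; split=> // k Pk; rewrite leqNgt; apply/negP => kn.
exact: IHm Pk (leq_trans kn nm).
Qed.

Theorem mainTheorem2 (t p : nat) (hp : 1 <= p - 2) (ht : p - 2 <= t) :
  exists c : int, exists n0 : nat, forall n : nat, n0 <= n ->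
    exists m : nat, is_sat t n p m /\ (m%:Z = t%:Z * n%:Z - c)%R.
Proof.
have [r r_gt0 pE] : exists2 r, 0 < r & p = r.+2 by exists (p - 2); lia.
subst p; have {hp}rt : r <= t by lia.
pose C := t * round_bound t t.
pose N := (t.+1 * round_bound t.+1 t.+1 + 2 * t + 2).+1.
have satE n : N <= n -> exists2 m, is_sat t n r.+2 m & m <= t * n <= m + C.
  move=> Nn; have [k adm_k kt] : exists2 k, admissible t r.+2 n k & k <= t * n.
    by apply: admissible_small => //; lia.
  have [m [adm_m min_m]] := least_nat (ex_intro _ k adm_k).
  exists m; first by split.
  rewrite (leq_trans (min_m _ adm_k) kt) /=; case: adm_m => G [satG tdeg <-].
  have := @saturated_edges_lb _ G t r satG; rewrite card_ord; apply=> x.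
  exact: leq_trans tdeg (min_degree_le G x).
have step n m m' : N <= n -> is_sat t n r.+2 m -> m <= t * n ->
    is_sat t n.+1 r.+2 m' -> m' <= m + t.
  move=> Nn [adm_m _] mt [_ min_m']; apply: min_m'.
  by apply: admissible_clone adm_m mt _ _; lia.
(* h = C - (t n - sat_t(n,p)) is a natural number, nonincreasing in n: its least
   value determines the constant *)
pose gap h := exists n m, [/\ N <= n, is_sat t n r.+2 m & m + C = t * n + h].
have [h [[n0 [m0 [Nn0 sat_m0 gap_m0]]] min_h]] : exists h, is_minimum gap h.
  apply: least_nat; have [m sat_m /andP[_ mC]] := satE N (leqnn N).
  by exists (m + C - t * N), N, m; split=> //; lia.
exists (C%:Z - h%:Z)%R, n0 => n n0n.
suff [m sat_m gap_m] : exists2 m, is_sat t n r.+2 m & m + C = t * n + h.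
  by exists m; split=> //; lia.
elim: n n0n => [|n IHn]; first by rewrite leqn0 => /eqP n00; exists m0; rewrite // -n00.
rewrite leq_eqVlt => /orP[/eqP<-|]; first by exists m0.
rewrite ltnS => n0n; have [m sat_m gap_m] := IHn n0n.
have Nn := leq_trans Nn0 n0n.
have [m' sat_m' /andP[_ mC]] := satE n.+1 (leqW Nn).
have [m2 sat_m2 /andP[m2t _]] := satE n Nn.
have mm2 : m <= m2 by case: sat_m => _; apply; case: sat_m2.
exists m' => //; have := step n m m' Nn sat_m (leq_trans mm2 m2t) sat_m'.
have : h <= m' + C - t * n.+1.
  apply: min_h; exists n.+1, m'; split=> //; first exact: leqW.
  by rewrite subnKC.
by rewrite mulnS in mC *; lia.
Qed.
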